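(* Let $F$ be an isonemal periodic fabric of order greater than $4$ whose symmetry group contains a quarter-turn symmetry (with or without side reversal), and suppose $F$ is perfectly coloured by thin striping. Then the resulting pattern, regarded as a design, is not the design of an isonemal prefabric that falls apart.
   Context: The plane is divided into unit square cells by a square grid. A prefabric consists of vertical strands (warps, columns of cells) and horizontal strands (wefts, rows of cells), with a specification in every cell of which strand is uppermost when viewed from the obverse. Its design colours a cell dark if the warp is uppermost and pale if the weft is uppermost; any dark/pale colouring of the cells, regarded as a design, determines a prefabric. A prefabric is periodic if invariant under two linearly independent translations; its order is the period of the up/down sequence along a strand. A symmetry is an isometry of the plane preserving the grid and the prefabric, possibly composed with side reversal $\tau$ (reflection in the plane of the prefabric, interchanging which strand is uppermost in every cell). The symmetry group is $G_1$; the prefabric is isonemal if $G_1$ is transitive on the set of all strands. A fabric is a prefabric that does not fall apart, where a prefabric falls apart if some nonempty proper subset $S$ of the strands is uppermost at every crossing of a strand of $S$ with a strand outside $S$. Thin striping colours warps alternately dark and pale and wefts alternately dark and pale (two possible choices); the pattern colours each cell with the colour of the strand uppermost there. The colouring is perfect if every symmetry in $G_1$ maps all dark strands to dark strands and all pale strands to pale strands, or interchanges the two colour classes of strands. *)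

(* Defs.v *)
From Stdlib Require Import ZArith Bool.
Open Scope Z_scope.

(* Cells of the square grid are indexed by (x, y) : Z * Z, x = column (warp),
   y = row (weft).  A design (and hence a prefabric) is a colouring of the
   cells: D x y = true (dark) iff the warp x is uppermost at cell (x, y). *)
Definition design := Z -> Z -> bool.

Inductive strand : Type := Warp (x : Z) | Weft (y : Z).

(* Isometries of the plane preserving the grid, acting on cells:
   (x, y) |-> (a, b) := if swap then (y, x) else (x, y), then
   x' = (+/-) a + tx, y' = (+/-) b + ty.  Every grid-preserving isometry
   induces exactly one such cell map (signed permutation + integer shift). *)
Record gridiso := GridIso { swap : bool; sx : bool; sy : bool; tx : Z; ty : Z }.

Definition sgn (s : bool) (z : Z) : Z := if s then - z else z.

Definition iso_cell (g : gridiso) (x y : Z) : Z * Z :=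
  let a := if swap g then y else x in
  let b := if swap g then x else y in
  (sgn (sx g) a + tx g, sgn (sy g) b + ty g).

Definition iso_strand (g : gridiso) (s : strand) : strand :=
  match s with
  | Warp x => if swap g then Weft (sgn (sy g) x + ty g)
              else Warp (sgn (sx g) x + tx g)
  | Weft y => if swap g then Warp (sgn (sx g) y + tx g)
              else Weft (sgn (sy g) y + ty g)
  end.

(* (g, tau) is a symmetry of the prefabric D (tau = side reversal):
   the strand uppermost at g(c) is the image of the strand uppermost at c,
   after interchanging uppermost/lowermost if tau. Since g maps warps to
   wefts exactly when swap g, this reads: *)
Definition is_sym (D : design) (g : gridiso) (tau : bool) : Prop :=
  forall x y, let c := iso_cell g x y in
    D (fst c) (snd c) = xorb (xorb (D x y) (swap g)) tau.

Definition quarter_turn (g : gridiso) : Prop := swap g = true /\ sx g <> sy g.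

Definition isonemal (D : design) : Prop :=
  forall s1 s2, exists g tau, is_sym D g tau /\ iso_strand g s1 = s2.

Definition periodic (D : design) : Prop :=
  exists a1 b1 a2 b2 : Z, a1 * b2 - a2 * b1 <> 0 /\
    (forall x y, D (x + a1) (y + b1) = D x y) /\
    (forall x y, D (x + a2) (y + b2) = D x y).

(* up/down sequence along a strand (true = the strand is up) *)
Definition updown (D : design) (s : strand) (k : Z) : bool :=
  match s with Warp x => D x k | Weft y => negb (D k y) end.

Definition has_period (u : Z -> bool) (p : Z) : Prop := forall k, u (k + p) = u k.

Definition order_gt4 (D : design) : Prop :=
  forall s p, 1 <= p <= 4 -> ~ has_period (updown D s) p.

Definition falls_apart (D : design) : Prop :=
  exists S : strand -> Prop, (exists s, S s) /\ (exists s, ~ S s) /\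
    forall x y,
      (S (Warp x) -> ~ S (Weft y) -> D x y = true) /\
      (S (Weft y) -> ~ S (Warp x) -> D x y = false).

Definition fabric (D : design) : Prop := ~ falls_apart D.

(* thin striping with parameters a b: warp x dark iff x+a odd,
   weft y dark iff y+b odd (covers both choices, up to translation) *)
Definition thin_striping (a b : Z) (s : strand) : bool :=
  match s with Warp x => Z.odd (x + a) | Weft y => Z.odd (y + b) end.

Definition pattern (D : design) (col : strand -> bool) : design :=
  fun x y => if D x y then col (Warp x) else col (Weft y).

Definition perfect (D : design) (col : strand -> bool) : Prop :=
  forall g tau, is_sym D g tau ->
    (forall s, col (iso_strand g s) = col s) \/
    (forall s, col (iso_strand g s) = negb (col s)).

(* Main.v *)
(** Parity of the two shifts of a symmetry is the key invariant.  Perfection of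
    the striping says that every symmetry [g] of [D] has [tx g] and [ty g] of
    equal parity, so a quarter-turn is centred on a cell and must reverse
    sides; hence translations never reverse sides.  A symmetry taking the warp
    through the centre of the quarter-turn to the next warp cannot act as a
    (glide) reflection, whose square would give period 2; so [D] is invariant
    under a translation [(1, t)] with [t] odd, hence also under [(-t, 1)].

    Call a cell mixed if its two strands have different colours.  A symmetry
    of the pattern taking a warp to a weft of the same colour turns out to
    complement [D] on mixed cells.  If it is a quarter-turn, combining it with
    that of [D] yields a translation complementing [D] on mixed cells; modulo
    [(1, t)] this is [(0, 2n)], and its odd multiple [(0, n(1 + t^2))]
    preserves [D].  If it is a (glide) reflection in a diagonal, conjugating
    [(1, t)] by it shows that [(t, 1)], hence [(0, 2)], preserves [D] on mixed
    cells, so [D] is constant there and cannot be complemented. *)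

Require Import Defs.
From Stdlib Require Import ZArith Bool Lia.

(** * Parity and quasi-periodic sequences *)

Lemma odd_sgn (s : bool) (z : Z) : Z.odd (sgn s z) = Z.odd z.
Proof. destruct s; simpl; [apply Z.odd_opp | reflexivity]. Qed.

(** Used for the period 1 + t^2 along a warp: it amounts to an odd number of steps of length 2. *)
Lemma odd_half_square_succ (t : Z) :
  Z.odd t = true -> exists M, 2 * M = 1 + t * t /\ Z.odd M = true.
Proof.
  intros Ht. apply Z.odd_spec in Ht. destruct Ht as [h ->].
  exists (2 * (h * h + h) + 1). split; [ring |].
  apply Z.odd_spec. eexists; reflexivity.
Qed.

Lemma even_half (n : Z) : Z.odd n = false -> exists h, n = 2 * h.
Proof.
  intros Hn. rewrite <- Z.negb_even in Hn. apply negb_false_iff in Hn.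
  apply Z.even_spec in Hn. exact Hn.
Qed.

Lemma quasi_period_multiple (f : Z -> bool) (s : Z) (e : bool) :
  (forall n, f (n + s) = xorb (f n) e) ->
  forall m n, f (n + m * s) = xorb (f n) (e && Z.odd m).
Proof.
  intros Hf.
  apply (Z.bi_induction (fun m => forall n, f (n + m * s) = xorb (f n) (e && Z.odd m))).
  - intros ? ? ->. reflexivity.
  - intros n. rewrite Z.mul_0_l, Z.add_0_r.
    now rewrite andb_false_r, xorb_false_r.
  - intros m.
    assert (Hs : forall n, f (n + Z.succ m * s) = xorb (f (n + m * s)) e).
    { intros n. rewrite <- Hf. f_equal. ring. }
    rewrite Z.odd_succ, <- Z.negb_odd.
    split; intros IH n; specialize (IH n); specialize (Hs n).
    + rewrite Hs, IH. now destruct (f n), e, (Z.odd m).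
    + rewrite Hs in IH.
      now destruct (f n), e, (Z.odd m), (f (n + m * s)).
Qed.

(** * Symmetries of a perfectly striped design *)

(** The two shifts decide the colour changes of [Warp 0] and [Weft 0], which must agree; under a
    swap, [a + b] enters both changes alike. *)
Lemma perfect_shift_parity (D : design) (a b : Z) (g : gridiso) (tau : bool) :
  perfect D (thin_striping a b) -> is_sym D g tau ->
  Z.odd (tx g) = Z.odd (ty g).
Proof.
  intros HP Hg.
  destruct g as [[] s1 s2 p q];
    destruct (HP _ _ Hg) as [H | H];
    pose proof (H (Warp 0)) as Hx; pose proof (H (Weft 0)) as Hy;
    simpl in *; rewrite !Z.odd_add, ?odd_sgn in Hx, Hy; simpl in *;
    destruct (Z.odd p), (Z.odd q), (Z.odd a), (Z.odd b); simpl in *; congruence.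
Qed.

(* Equal parity puts the centre on a cell, which the symmetry must fix. *)
Lemma quarter_turn_reverses_sides (D : design) (g : gridiso) (tau : bool) :
  quarter_turn g -> is_sym D g tau -> Z.odd (tx g) = Z.odd (ty g) ->
  tau = true.
Proof.
  destruct g as [w s1 s2 p q]; intros [Hw Hs] Hg Hpq; simpl in *; subst w.
  destruct (even_half (p + q)) as [h Hh].
  { rewrite Z.odd_add, Hpq. apply xorb_nilpotent. }
  destruct s1, s2; try congruence.
  - specialize (Hg (h - q) h). cbn in Hg.
    replace (- h + p) with (h - q) in Hg by lia.
    replace (h - q + q) with h in Hg by lia.
    destruct (D (h - q) h), tau; simpl in Hg; congruence.
  - specialize (Hg h (h - p)). cbn in Hg.
    replace (h - p + p) with h in Hg by lia.
    replace (- h + q) with (h - p) in Hg by lia.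
    destruct (D h (h - p)), tau; simpl in Hg; congruence.
Qed.

Section PerfectQuarterTurn.

Variables (D : design) (a b : Z).
Hypothesis HD : perfect D (thin_striping a b).

(** Interchanging warps with wefts and reversing sides cancel, so the turn about the cell (cx, cy)
    preserves [D] itself. *)
Lemma perfect_quarter_turn_centre :
  (exists g tau, quarter_turn g /\ is_sym D g tau) ->
  exists cx cy, forall x y, D (cx + cy - y) (cy - cx + x) = D x y.
Proof.
  intros [g [tau [Hq Hg]]].
  pose proof (perfect_shift_parity _ _ _ _ _ HD Hg) as Hpar.
  pose proof (quarter_turn_reverses_sides _ _ _ Hq Hg Hpar) as ->.
  destruct g as [w s1 s2 p q]; destruct Hq as [Hw Hs]; simpl in *; subst w.
  destruct (even_half (p + q)) as [h Hh].
  { rewrite Z.odd_add, Hpar. apply xorb_nilpotent. }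
  destruct s1, s2; try congruence.
  - exists (h - q), h. intros x y. specialize (Hg x y). cbn in Hg.
    replace (h - q + h - y) with (- y + p) by lia.
    replace (h - (h - q) + x) with (x + q) by lia.
    rewrite Hg. now destruct (D x y).
  (* This turn has the opposite sense, so its inverse is used. *)
  - exists h, (h - p). intros x y.
    specialize (Hg (h + (h - p) - y) (h - p - h + x)).
    cbn [iso_cell swap sx sy tx ty sgn fst snd] in Hg.
    replace (h - p - h + x + p) with x in Hg by lia.
    replace (- (h + (h - p) - y) + q) with y in Hg by lia.
    rewrite Hg. now destruct (D (h + (h - p) - y) (h - p - h + x)).
Qed.

Variables (cx cy : Z).
Hypothesis Hrho : forall x y, D (cx + cy - y) (cy - cx + x) = D x y.

Lemma half_turn x y : D (2 * cx - x) (2 * cy - y) = D x y.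
Proof.
  rewrite <- (Hrho x y), <- (Hrho (cx + cy - y)). f_equal; lia.
Qed.

(** The quarter-turn followed by the translation is again a quarter-turn and must reverse sides too,
    so the translation cannot. *)
Lemma perfect_translation_keeps_sides (s t : Z) (tau : bool) :
  (forall x y, D (x + s) (y + t) = xorb (D x y) tau) ->
  (forall x y, D (x + s) (y + t) = D x y) /\ Z.odd s = Z.odd t.
Proof.
  intros H.
  assert (Ht : is_sym D (GridIso false false false s t) tau).
  { intros x y. cbn. rewrite H. now destruct (D x y), tau. }
  assert (Hq : is_sym D (GridIso true true false (cx + cy + s) (cy - cx + t)) (negb tau)).
  { intros x y. cbn.
    replace (- y + (cx + cy + s)) with (cx + cy - y + s) by lia.
    replace (x + (cy - cx + t)) with (cy - cx + x + t) by lia.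
    rewrite H, Hrho. now destruct (D x y), tau. }
  assert (Htau : negb tau = true).
  { eapply quarter_turn_reverses_sides; [| exact Hq |].
    - split; [reflexivity | discriminate].
    - exact (perfect_shift_parity _ _ _ _ _ HD Hq). }
  apply negb_true_iff in Htau. subst tau. split.
  - intros x y. rewrite H. apply xorb_false_r.
  - exact (perfect_shift_parity _ _ _ _ _ HD Ht).
Qed.

Lemma glide_reflection_period (t : Z) (tau : bool) :
  (forall x y, D (x + 1) (t - y) = xorb (D x y) tau) -> ~ order_gt4 D.
Proof.
  intros H Ho. apply (Ho (Weft 0) 2); [lia |].
  intros k. simpl. f_equal.
  replace (D (k + 2) 0) with (D (k + 1 + 1) (t - (t - 0))) by (f_equal; lia).
  rewrite !H. now destruct (D k 0), tau.
Qed.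

Lemma unit_warp_translation :
  isonemal D -> order_gt4 D ->
  exists t, Z.odd t = true /\ forall x y, D (x + 1) (y + t) = D x y.
Proof.
  intros Hi Ho.
  (* The half-turn about the centre fixes the warp [cx], so composing with it makes any reversal of
     the warp order a shift by 1. *)
  destruct (Hi (Warp cx) (Warp (cx + 1))) as [[w s1 s2 p q] [tau [Hg E]]].
  destruct w; simpl in E; [discriminate |].
  injection E as E.
  assert (Hg' : forall x y, D (sgn s1 x + p) (sgn s2 y + q) = xorb (D x y) tau).
  { intros x y. specialize (Hg x y). cbn in Hg. rewrite Hg. now rewrite xorb_false_r. }
  clear Hg.
  assert (Htr : forall t, (forall x y, D (x + 1) (y + t) = xorb (D x y) tau) ->
    exists t, Z.odd t = true /\ forall x y, D (x + 1) (y + t) = D x y).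
  { intros t H. destruct (perfect_translation_keeps_sides _ _ _ H) as [H1 H2].
    exists t. now split. }
  destruct s1, s2; simpl in *.
  - apply (Htr (q - 2 * cy)). intros x y.
    rewrite <- (half_turn x y), <- Hg'. f_equal; lia.
  - exfalso. apply (glide_reflection_period (2 * cy + q) tau); [| exact Ho].
    intros x y. rewrite <- (half_turn x y), <- Hg'. f_equal; lia.
  - exfalso. apply (glide_reflection_period q tau); [| exact Ho].
    intros x y. rewrite <- Hg'. f_equal; lia.
  - apply (Htr q). intros x y. rewrite <- Hg'. f_equal; lia.
Qed.

End PerfectQuarterTurn.

(** * Symmetries of the pattern *)

Lemma pattern_unit_translation (D : design) (a b t : Z) :
  Z.odd t = true -> (forall x y, D (x + 1) (y + t) = D x y) ->
  forall x y, pattern D (thin_striping a b) (x + 1) (y + t)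
              = negb (pattern D (thin_striping a b) x y).
Proof.
  intros Ht H x y. unfold pattern, thin_striping. rewrite H.
  rewrite !Z.odd_add, Ht. simpl.
  now destruct (D x y), (Z.odd x), (Z.odd y), (Z.odd a), (Z.odd b).
Qed.

(* [u] and [v] stand for a pale warp and a pale weft of the pattern, [e] and
   [c] for the symmetry mapping one to the other. *)
Lemma pale_strand_match (u v : Z -> bool) (s e : bool) (c m : Z) :
  (forall n, Z.odd n = false -> u n = false) ->
  (forall n, Z.odd n = false -> v n = false) ->
  (forall n, v (sgn s n + c) = xorb (u n) e) ->
  Z.odd m = true -> v 1 = negb (u m) ->
  e = false /\ Z.odd c = false.
Proof.
  intros Hu Hv H Hm H1.
  destruct (Z.odd c) eqn:Hc.
  - exfalso.
    assert (E1 : v 1 = e).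
    { replace 1 with (sgn s (sgn s (1 - c)) + c) by (destruct s; cbn [sgn]; lia).
      rewrite H, Hu; [apply xorb_false_l |].
      rewrite odd_sgn, Z.odd_sub, Hc. reflexivity. }
    assert (E2 : u m = e).
    { specialize (H m). rewrite Hv in H.
      - destruct (u m), e; simpl in H; congruence.
      - rewrite Z.odd_add, odd_sgn, Hm, Hc. reflexivity. }
    rewrite E1, E2 in H1. now destruct e.
  - split; [| reflexivity].
    specialize (H 0). rewrite (Hu 0 eq_refl), Hv in H.
    + now destruct e.
    + rewrite Z.odd_add, odd_sgn, Hc. reflexivity.
Qed.

Lemma pattern_isonemal_complement (D : design) (a b t : Z) :
  Z.odd t = true -> (forall x y, D (x + 1) (y + t) = D x y) ->
  isonemal (pattern D (thin_striping a b)) ->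
  exists s1 s2 p q, Z.odd p = Z.odd (a + b) /\ Z.odd q = Z.odd (a + b) /\
    forall x y, Z.odd (x + y) = negb (Z.odd (a + b)) ->
      D (sgn s1 y + p) (sgn s2 x + q) = negb (D x y).
Proof.
  intros Ht Htr Hi.
  pose proof (pattern_unit_translation D a b t Ht Htr) as HPt.
  (* Both strands are pale in the striping. *)
  destruct (Hi (Warp (- a)) (Weft (- b))) as [[w s1 s2 p q] [tau [Hg E]]].
  destruct w; simpl in E; [| discriminate].
  injection E as E.
  assert (Hg' : forall x y,
    pattern D (thin_striping a b) (sgn s1 y + p) (sgn s2 x + q)
    = xorb (pattern D (thin_striping a b) x y) (negb tau)).
  { intros x y. specialize (Hg x y). cbn in Hg. rewrite Hg.
    now destruct (pattern _ _ x y), tau. }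
  clear Hg.
  assert (Hq : Z.odd q = Z.odd (a + b)).
  { apply (f_equal Z.odd) in E.
    rewrite Z.odd_add, odd_sgn, !Z.odd_opp in E. rewrite Z.odd_add.
    now destruct (Z.odd a), (Z.odd b), (Z.odd q). }
  (* Positions are shifted so that even [n] is a crossing with a pale strand; (1, t) takes position
     [-t] of the warp to position 1 of the weft. *)
  destruct (pale_strand_match
    (fun n => pattern D (thin_striping a b) (- a) (n - b))
    (fun n => pattern D (thin_striping a b) (n - a) (- b))
    s1 (negb tau) (p + a - sgn s1 b) (- t)) as [Htau Hp].
  - intros n Hn. unfold pattern, thin_striping.
    replace (- a + a) with 0 by lia. replace (n - b + b) with n by lia.
    rewrite Hn. now destruct (D _ _).
  - intros n Hn. unfold pattern, thin_striping.
    replace (- b + b) with 0 by lia. replace (n - a + a) with n by lia.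
    rewrite Hn. now destruct (D _ _).
  - intros n. rewrite <- Hg', E. f_equal. destruct s1; cbn [sgn]; lia.
  - now rewrite Z.odd_opp.
  - cbn beta. rewrite <- HPt. f_equal; lia.
  - rewrite Z.odd_sub, Z.odd_add, odd_sgn in Hp.
    exists s1, s2, p, q. split; [| split; [exact Hq |]].
    + rewrite Z.odd_add. now destruct (Z.odd p), (Z.odd a), (Z.odd b).
    (* By the parities of [p] and [q], each strand has the colour of its image. At a mixed cell,
       equal pattern colours thus put the image of the upper strand on top, and it is of the other
       kind. *)
    + intros x y Hxy. specialize (Hg' x y). rewrite Htau in Hg'.
      unfold pattern, thin_striping in Hg'.
      rewrite !Z.odd_add, !odd_sgn in Hg'. rewrite !Z.odd_add in *.
      destruct (D (sgn s1 y + p) (sgn s2 x + q)), (D x y); simpl in *; trivial;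
      destruct (Z.odd x), (Z.odd y), (Z.odd a), (Z.odd b), (Z.odd p), (Z.odd q);
      simpl in *; congruence.
Qed.

(** * Complementation on mixed cells, those with x + y of parity [o] *)

Section MixedCells.

Variables (D : design) (cx cy t : Z) (o : bool).
Hypothesis Hrho : forall x y, D (cx + cy - y) (cy - cx + x) = D x y.
Hypothesis Ht : Z.odd t = true.
Hypothesis Htr : forall x y, D (x + 1) (y + t) = D x y.

Lemma rotated_translation x y : D (x - t) (y + 1) = D x y.
Proof.
  rewrite <- (Hrho (x - t)), <- (Hrho x y), <- (Htr (cx + cy - (y + 1))).
  f_equal; lia.
Qed.

Lemma translation_multiple m x y : D (x + m) (y + t * m) = D x y.
Proof.
  assert (H : forall n, D (x + (n + 1)) (y + t * (n + 1))
                        = xorb (D (x + n) (y + t * n)) false).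
  { intros n. rewrite xorb_false_r, <- (Htr (x + n)). f_equal; ring. }
  pose proof (quasi_period_multiple (fun n => D (x + n) (y + t * n)) _ _ H m 0) as E.
  cbn beta in E. rewrite andb_false_l, xorb_false_r in E.
  transitivity (D (x + 0) (y + t * 0)); [rewrite <- E |]; f_equal; ring.
Qed.

Lemma shear_to_warp x x0 y : D x y = D x0 (y + t * (x0 - x)).
Proof. rewrite <- (translation_multiple (x0 - x) x y). f_equal; ring. Qed.

(** (0, 1 + t^2) is (-t, 1) plus [t] times (1, t). *)
Lemma warp_period x y : D x (y + (1 + t * t)) = D x y.
Proof.
  rewrite <- (rotated_translation x y), (shear_to_warp (x - t) x). f_equal; ring.
Qed.

Lemma no_complementing_translation (w1 w2 : Z) :
  Z.odd w1 = Z.odd w2 ->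
  ~ (forall x y, Z.odd (x + y) = o -> D (x + w1) (y + w2) = negb (D x y)).
Proof.
  intros Hw H.
  destruct (odd_half_square_succ t Ht) as [M [HM HMo]].
  destruct (even_half (w2 - t * w1)) as [h Hh].
  { rewrite Z.odd_sub, Z.odd_mul, Ht, Hw. apply xorb_nilpotent. }
  set (y0 := if o then 1 else 0).
  assert (Ho : forall n, Z.odd (0 + (y0 + 2 * n)) = o).
  { intros n. rewrite !Z.odd_add, Z.odd_mul. unfold y0. now destruct o. }
  (* [F] samples the mixed cells of warp 0. *)
  pose (F := fun n => D 0 (y0 + 2 * n)).
  assert (F1 : forall n, F (n + h) = xorb (F n) true).
  { intros n. unfold F. rewrite xorb_true_r, <- (H _ _ (Ho n)).
    rewrite (shear_to_warp (0 + w1) 0). f_equal. lia. }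
  assert (F2 : forall n, F (n + M) = xorb (F n) false).
  { intros n. unfold F. rewrite xorb_false_r, <- (warp_period 0 (y0 + 2 * n)).
    f_equal. lia. }
  (* The shift by [h * M] complements as an odd multiple of [h], yet preserves as a multiple of
     [M]. *)
  pose proof (quasi_period_multiple _ _ _ F1 M 0) as E1.
  pose proof (quasi_period_multiple _ _ _ F2 h 0) as E2.
  rewrite HMo in E1. rewrite (Z.mul_comm h M), E1 in E2.
  now destruct (F 0).
Qed.

Lemma no_complementing_quarter_turn (s : bool) (p q : Z) :
  Z.odd p = Z.odd q ->
  ~ (forall x y, Z.odd (x + y) = o ->
       D (sgn s y + p) (sgn (negb s) x + q) = negb (D x y)).
Proof.
  intros Hpq H.
  destruct s; simpl in H.
  (* Same sense as the fixed quarter-turn: compose with the inverse of the latter. In the other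
     case, compose with the quarter-turn itself. *)
  - apply (no_complementing_translation (p - (cx + cy)) (q - (cy - cx))).
    { rewrite !Z.odd_sub, Z.odd_add, Hpq.
      now destruct (Z.odd q), (Z.odd cx), (Z.odd cy). }
    intros x y Hxy.
    replace (D x y) with (D (y - (cy - cx)) (cx + cy - x))
      by (rewrite <- Hrho; f_equal; lia).
    rewrite <- H.
    + f_equal; lia.
    + rewrite <- Hxy, Z.odd_add, !Z.odd_sub, !Z.odd_add.
      now destruct (Z.odd x), (Z.odd y), (Z.odd cx), (Z.odd cy).
  - apply (no_complementing_translation (p + (cy - cx)) (q - (cx + cy))).
    { rewrite Z.odd_add, !Z.odd_sub, Z.odd_add, Hpq.
      now destruct (Z.odd q), (Z.odd cx), (Z.odd cy). }
    intros x y Hxy.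
    rewrite <- (Hrho x y), <- H.
    + f_equal; lia.
    + rewrite <- Hxy, !Z.odd_add, !Z.odd_sub, Z.odd_add.
      now destruct (Z.odd x), (Z.odd y), (Z.odd cx), (Z.odd cy).
Qed.

Lemma no_complementing_reflection (s : bool) (p q : Z) :
  Z.odd p = Z.odd q ->
  ~ (forall x y, Z.odd (x + y) = o ->
       D (sgn s y + p) (sgn s x + q) = negb (D x y)).
Proof.
  intros Hpq H.
  assert (Hz : forall x y, Z.odd (x + y) = o -> D (x + t) (y + 1) = D x y).
  { intros x y Hxy.
    (* The preimage of (x, y). Conjugation complements twice, which cancels. *)
    set (x' := sgn s (y - q)). set (y' := sgn s (x - p)).
    assert (Hx' : Z.odd x' = xorb (Z.odd y) (Z.odd q))
      by (unfold x'; now rewrite odd_sgn, Z.odd_sub).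
    assert (Hy' : Z.odd y' = xorb (Z.odd x) (Z.odd q))
      by (unfold y'; now rewrite odd_sgn, Z.odd_sub, Hpq).
    assert (Ho' : Z.odd (x' + y') = o).
    { rewrite <- Hxy, !Z.odd_add, Hx', Hy'.
      now destruct (Z.odd x), (Z.odd y), (Z.odd q). }
    pose proof (H x' y' Ho') as E1.
    replace (sgn s y' + p) with x in E1
      by (unfold y'; destruct s; cbn [sgn]; lia).
    replace (sgn s x' + q) with y in E1
      by (unfold x'; destruct s; cbn [sgn]; lia).
    destruct s; simpl in H.
    (* With negative signs (1, t) is conjugate to (-t, -1), so the step is taken backwards. *)
    - assert (E2 := H (x' - 1) (y' - t)).
      replace (- (y' - t) + p) with (x + t) in E2 by (unfold y'; cbn [sgn]; lia).
      replace (- (x' - 1) + q) with (y + 1) in E2 by (unfold x'; cbn [sgn]; lia).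
      rewrite E2, E1.
      + rewrite <- (Htr (x' - 1)). f_equal; f_equal; lia.
      + rewrite <- Ho', !Z.odd_add, !Z.odd_sub, Ht.
        now destruct (Z.odd x'), (Z.odd y').
    - assert (E2 := H (x' + 1) (y' + t)).
      replace (y' + t + p) with (x + t) in E2 by (unfold y'; cbn [sgn]; lia).
      replace (x' + 1 + q) with (y + 1) in E2 by (unfold x'; cbn [sgn]; lia).
      rewrite E2, E1.
      + now rewrite Htr.
      + rewrite <- Ho', !Z.odd_add, Ht.
        now destruct (Z.odd x'), (Z.odd y'). }
  (* (0, 2) is the sum of (t, 1) and (-t, 1). *)
  assert (Hc : forall x y, Z.odd (x + y) = o -> D x (y + 2) = D x y).
  { intros x y Hxy. rewrite <- (Hz x y Hxy), <- (rotated_translation (x + t)).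
    f_equal; lia. }
  set (y0 := if o then 1 else 0).
  assert (Hconst : forall x y, Z.odd (x + y) = o -> D x y = D 0 y0).
  { intros x y Hxy. rewrite (shear_to_warp x 0).
    destruct (even_half (y + t * (0 - x) - y0)) as [h Hh].
    { rewrite Z.odd_sub, Z.odd_add, Z.odd_mul, Z.odd_sub, Ht.
      rewrite Z.odd_add in Hxy. unfold y0.
      destruct o, (Z.odd x), (Z.odd y); simpl in *; congruence. }
    replace (y + t * (0 - x)) with (y0 + 2 * (0 + h * 1)) by lia.
    rewrite (quasi_period_multiple (fun n => D 0 (y0 + 2 * n)) 1 false).
    - simpl. rewrite xorb_false_r. f_equal. lia.
    - intros n. rewrite xorb_false_r, <- (Hc 0 (y0 + 2 * n)).
      + f_equal. lia.
      + rewrite !Z.odd_add, Z.odd_mul. unfold y0. now destruct o. }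
  assert (Ho : Z.odd (0 + y0) = o) by (unfold y0; now destruct o).
  (* As [p] and [q] have equal parity, the image of (0, y0) is again mixed. *)
  pose proof (H 0 y0 Ho) as E.
  rewrite Hconst in E.
  - now destruct (D 0 y0).
  - rewrite <- Ho, !Z.odd_add, !odd_sgn, Hpq.
    now destruct (Z.odd y0), (Z.odd q).
Qed.

End MixedCells.

Theorem theorem3p3 (D : design) (a b : Z) :
  fabric D -> periodic D -> isonemal D -> order_gt4 D ->
  (exists g tau, quarter_turn g /\ is_sym D g tau) ->
  perfect D (thin_striping a b) ->
  ~ (isonemal (pattern D (thin_striping a b)) /\
     falls_apart (pattern D (thin_striping a b))).
Proof.
  intros _ _ Hi Ho Hq HP [HPi _].
  destruct (perfect_quarter_turn_centre D a b HP Hq) as [cx [cy Hrho]].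
  destruct (unit_warp_translation D a b HP cx cy Hrho Hi Ho) as [t [Ht Htr]].
  destruct (pattern_isonemal_complement D a b t Ht Htr HPi)
    as [s1 [s2 [p [q [Hp [Hq' H]]]]]].
  rewrite <- Hq' in Hp.
  (* Equal signs give a (glide) reflection in a diagonal, opposite signs a quarter-turn. *)
  destruct (bool_dec s2 s1) as [-> | Hs].
  - exact (no_complementing_reflection D cx cy t _ Hrho Ht Htr s1 p q Hp H).
  - replace s2 with (negb s1) in H by (destruct s1, s2; simpl; congruence).
    exact (no_complementing_quarter_turn D cx cy t _ Hrho Ht Htr s1 p q Hp H).
Qed.
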